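(* For $n\ge0$ let $\tau_{n,k}$ be the number of $\mathbf a\in\mathcal{DP}(n)$ with $\mathrm{twin}(\Gamma_{\mathbf a})=k$, and let $\mathrm{twin}_n(t)=\sum_{\mathbf a\in\mathcal{DP}(n)}t^{\mathrm{twin}(\Gamma_{\mathbf a})}=\sum_{k=0}^n\tau_{n,k}t^k$. Then for each $n\ge0$, $$\tau_{n+1,k}=\binom nkM_{n-k}$$ for all $0\le k\le n+1$, where $M_j$ is the $j$th Motzkin number, from which it follows that the twin statistic is distributed as the triangle OEIS A091869 over all Dyck paths. In particular (for each $n\ge 0$), $$\mathrm{twin}_n(t)=(1+t)^{n-1}\,{}_2F_1\!\left(-\frac{n-1}{2},\frac{2-n}{2};2;\frac{4}{(1+t)^2}\right).$$
   Context: Write $[n]=\{1,\dots,n\}$. An area sequence of size $n$ is a sequence $\mathbf a=(a_1,\dots,a_n)$ of nonnegative integers with $a_i<i$ for all $i$ and $a_i\le a_{i-1}+1$ for all $i\ge 2$; $\mathcal{DP}(n)$ is the set of all of them (they are in bijection with Dyck paths of semilength $n$; for $n=0$ there is only the empty sequence, giving the empty graph). Each $\mathbf a$ defines a graph $\Gamma_{\mathbf a}$ (a unit interval graph) on $[n]$ with edges $\{j,i\}$ for $1\le j<i\le n$ with $i-a_i\le j$. The twin number $\mathrm{twin}(\Gamma_{\mathbf a})$ is the number of pairs $(j,j+1)$ of adjacent vertices with $N(j)\setminus\{j+1\}=N(j+1)\setminus\{j\}$, where $N(i)$ is the set of neighbors of $i$. The Motzkin number $M_k$ is the number of lattice paths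 from $(0,0)$ to $(k,0)$ with steps $(1,1),(1,-1),(1,0)$ never going below the $x$-axis; for $k=n+1$ the right-hand side of the coefficient formula is read as $0$, since $\binom{n}{n+1}=0$. The OEIS triangle A091869 has entries $T(m,k)=\binom{m-1}{k}M_{m-1-k}$. ${}_2F_1$ is the ordinary hypergeometric function.
   Formalization: The hypergeometric formula is stated for n ≥ 1 (and t ≠ −1, where 4/(1+t)² is defined) rather than n ≥ 0: at n = 0 it is false, since twin_0(t) = 1 while at t = 3 the right-hand side is about 0.268. *)

(* Defs.v *)
From HB Require Import structures.
From mathcomp Require Import all_boot all_order all_algebra.
From mathcomp Require Import all_classical all_reals all_analysis.
Set Implicit Arguments.
Unset Strict Implicit.
Unset Printing Implicit Defensive.
Import Order.TTheory GRing.Theory Num.Theory.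
Import numFieldNormedType.Exports.

Local Open Scope ring_scope.

(* The index i : 'I_n stands for i + 1 in {1, ..., n}. Since a_i < i <= n for
   1-based i, taking the values in 'I_n loses no area sequence; the condition
   a_i < i reads a i <= i for 0-based i. *)
Definition area_seq (n : nat) (a : {ffun 'I_n -> 'I_n}) : bool :=
  [forall i : 'I_n, (a i <= i)%N] &&
  [forall i : 'I_n, forall j : 'I_n,
     (nat_of_ord j == i.+1) ==> (a j <= (a i).+1)%N].

Definition DP (n : nat) : {set {ffun 'I_n -> 'I_n}} :=
  [set a | area_seq a].

(* The defining inequality i - a_i <= j is invariant under the index shift, and
   the subtraction never truncates because a i <= i. *)
Definition Gamma (n : nat) (a : {ffun 'I_n -> 'I_n}) : rel 'I_n :=
  fun i j => ((j < i)%N && (i - a i <= j)%N) || ((i < j)%N && (j - a j <= i)%N).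

Definition neighbors (n : nat) (e : rel 'I_n) (i : 'I_n) : {set 'I_n} :=
  [set j | e i j].

Definition twin (n : nat) (e : rel 'I_n) : nat :=
  #|[set p : 'I_n * 'I_n |
      [&& nat_of_ord p.2 == p.1.+1, e p.1 p.2 &
          neighbors e p.1 :\ p.2 == neighbors e p.2 :\ p.1]]|.

Definition tau (n k : nat) : nat := #|[set a in DP n | twin (Gamma a) == k]|.

Definition twin_poly (R : nzRingType) (n : nat) : {poly R} :=
  \sum_(a in DP n) 'X^(twin (Gamma a)).

(* Some true, Some false, None encode the steps (1,1), (1,-1), (1,0). *)
Definition step_dy (s : option bool) : int :=
  if s is Some b then (if b then 1 else -1) else 0.

Definition path_height (p : seq (option bool)) : int := \sum_(s <- p) step_dy s.

Definition motzkin (k : nat) : nat :=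
  #|[set p : k.-tuple (option bool) |
      [forall j : 'I_k.+1, 0 <= path_height (take j p)] &&
      (path_height p == 0)]|.

(* Rows are indexed by m >= 1; outside the triangle (k >= m) the binomial
   coefficient makes the value 0. *)
Definition A091869 (m k : nat) : nat := ('C(m.-1, k) * motzkin (m.-1 - k))%N.

Definition pochhammer (K : pzRingType) (a : K) (k : nat) : K :=
  \prod_(i < k) (a + i%:R).

Definition hyp2F1_term (K : numFieldType) (a b c z : K) (k : nat) : K :=
  pochhammer a k * pochhammer b k / (pochhammer c k * k`!%:R) * z ^+ k.

(* Meaningful where the series converges, in particular for every z when a or b
   is a nonpositive integer (hyp2F1_terminating); there is no analytic
   continuation beyond the disc of convergence. *)
Definition hyp2F1 (K : numFieldType) (a b c z : K) : K :=
  limn (series (hyp2F1_term a b c z)).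

Lemma pochhammer_negnat (K : pzRingType) (m k : nat) :
  (m < k)%N -> pochhammer (- m%:R : K) k = 0.
Proof.
elim: k => // k IHk; rewrite ltnS leq_eqVlt /pochhammer big_ord_recr /=.
case/predU1P => [->|mk]; first by rewrite addNr mulr0.
by rewrite -/(pochhammer _ k) IHk // mul0r.
Qed.

Lemma hyp2F1C (K : numFieldType) (a b c z : K) :
  hyp2F1 a b c z = hyp2F1 b a c z.
Proof.
rewrite /hyp2F1; congr (limn (series _)).
by apply/funext => k; rewrite /hyp2F1_term (mulrC (pochhammer a k)).
Qed.

Lemma hyp2F1_terminating (K : numFieldType) (m : nat) (b c z : K) :
  hyp2F1 (- m%:R) b c z = \sum_(k < m.+1) hyp2F1_term (- m%:R) b c z k.
Proof.
rewrite /hyp2F1; apply: cvg_lim => //.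
apply: cvg_near_cst; near=> N.
have mN : (m.+1 <= N)%N by near: N; exact: nbhs_infty_ge.
rewrite /series /= (big_cat_nat _ mN) //= big_mkord.
rewrite [X in _ + X]big_nat_cond [X in _ + X]big1 ?addr0 // => k.
move=> /andP[/andP[mk _] _]; by rewrite /hyp2F1_term pochhammer_negnat // !mul0r.
Unshelve. all: by end_near. Qed.

(* Main.v *)
Require Import Defs.
From HB Require Import structures.
From mathcomp Require Import all_boot all_order all_algebra.
From mathcomp Require Import all_classical all_reals all_analysis.
From mathcomp Require Import zify ring.
Import Order.TTheory GRing.Theory Num.Theory.
Import numFieldNormedType.Exports.
Set Implicit Arguments.
Unset Strict Implicit.
Unset Printing Implicit Defensive.

Local Open Scope ring_scope.

(* Put l_i = i - a_i, so that the area sequences of size n + 1 become the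
   weakly increasing sequences l_0, ..., l_n with l_i <= i. Then (j, j+1) is a
   twin pair iff l_j = l_{j+1} and j + 1 is not a value of l. Record the bits
   u_j = [l_j < l_{j+1}] and v_j = [j + 1 is a value of l] for j < n. The k-th
   new value of l is entered at the k-th ascent, so l_i is the first x at which
   v_0 + ... + v_{x-1} reaches u_0 + ... + u_{i-1}; the words (u, v) that arise
   are therefore those in which the v's dominate the u's on every prefix, with
   equality at the end: Motzkin words whose level steps have two colours (0,0)
   and (1,1), the first colour marking the twins. Choosing the places of the k
   twins leaves a Motzkin word of length n - k. Removing the level steps of a
   Motzkin word in the same way gives M_m = sum_i C(m, i) B_i with B_i the
   number of Dyck words of length i, whence
   twin_{n+1}(t) = sum_i C(n, i) B_i (1 + t)^(n - i). *)

(** * Counting words by removing level steps *)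

Lemma card_tuple_cons (T : finType) (n : nat) (P : pred (seq T)) :
  #|[set w : n.+1.-tuple T | P w]| =
  (\sum_(s : T) #|[set w : n.-tuple T | P (s :: w)]|)%N.
Proof.
rewrite -sum1_card (eq_bigl (fun w : n.+1.-tuple T => P w)); last first.
  by move=> w; rewrite inE.
have sumE s : #|[set w : n.-tuple T | P (s :: w)]| =
    (\sum_(w : n.-tuple T | P (s :: w)) 1)%N.
  by rewrite -sum1_card; apply: eq_bigl => w; rewrite inE.
under [RHS]eq_bigr => s _ do rewrite sumE.
rewrite (pair_big_dep xpredT (fun (s : T) (w : n.-tuple T) => P (s :: w))
          (fun _ _ => 1%N)) /=.
rewrite (reindex (fun p : T * n.-tuple T => [tuple of p.1 :: p.2])) //=.
exists (fun w : n.+1.-tuple T => (thead w, [tuple of behead w])).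
  by move=> [s w] _ /=; congr pair; apply: val_inj.
by move=> w _; rewrite [RHS]tuple_eta.
Qed.

Lemma sum_option (T : finType) (F : option T -> nat) :
  (\sum_(s : option T) F s = F None + \sum_(s : T) F (Some s))%N.
Proof.
rewrite (bigD1 None) //=; congr addn.
rewrite (reindex_omap (@Some T) id) /=; last by case.
by apply: eq_bigl => s; rewrite eqxx.
Qed.

Section Excursions.
Variables (T : Type) (dy : T -> int).

(** An arbitrary step function lets one notion cover Dyck words ([pm_dy]), Motzkin words ([step_dy])
    and two-coloured Motzkin words ([oapp step_dy 0]); the starting height varies for the
    induction. *)
Fixpoint excursion (h : int) (w : seq T) : bool :=
  (0 <= h) && (if w is s :: w' then excursion (h + dy s) w' else h == 0).

Lemma excursion_neg (h : int) (w : seq T) : h < 0 -> excursion h w = false.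
Proof. by case: w => [|s w] /=; rewrite ltNge => /negPf ->. Qed.

Lemma excursionP (h : int) (w : seq T) :
  reflect ((forall j, (j <= size w)%N -> 0 <= h + \sum_(s <- take j w) dy s)
           /\ h + \sum_(s <- w) dy s = 0)
          (excursion h w).
Proof.
elim: w h => [|s w IHw] h /=.
  apply: (iffP andP) => [[h0 /eqP ->]|[h0]].
    by split=> [j _|]; rewrite ?take_nil big_nil addr0.
  rewrite big_nil addr0 => ->; by [].
apply: (iffP andP) => [[h0 /IHw[ge0 eq0]]|[ge0 eq0]].
  split=> [[|j] lejw|]; last by rewrite big_cons addrA.
    by rewrite big_nil addr0.
  by rewrite big_cons addrA; apply: ge0.
split; first by have := ge0 0%N isT; rewrite take0 big_nil addr0.
apply/IHw; split=> [j lejw|]; last by move: eq0; rewrite big_cons addrA.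
by have := ge0 j.+1 lejw; rewrite /= big_cons addrA.
Qed.
End Excursions.

Definition num_excursions (T : finType) (dy : T -> int) (n : nat) (h : int) :=
  #|[set w : n.-tuple T | excursion dy h w]|.

Lemma num_excursions_neg (T : finType) (dy : T -> int) n (h : int) :
  h < 0 -> num_excursions dy n h = 0%N.
Proof.
move=> h0; apply/eqP; rewrite cards_eq0; apply/eqP/setP=> w.
by rewrite !inE excursion_neg.
Qed.

Lemma num_excursions0 (T : finType) (dy : T -> int) (h : int) :
  num_excursions dy 0 h = (h == 0).
Proof.
rewrite /num_excursions (_ : [set w | _] =
    if h == 0 then [set: 0.-tuple T] else finset.set0).
  by case: eqP => _; rewrite ?cards0 // cardsT card_tuple.
apply/setP=> w; rewrite inE tuple0 /=.
by case: eqP => [->|_]; rewrite ?lexx ?andbF !inE.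
Qed.

Lemma num_excursionsS (T : finType) (dy : T -> int) n (h : int) : 0 <= h ->
  num_excursions dy n.+1 h = (\sum_(s : T) num_excursions dy n (h + dy s))%N.
Proof. by move=> h0; rewrite /num_excursions card_tuple_cons /= h0. Qed.

(** Level steps [None] do not move the height, so deleting them keeps an excursion and only their
    places are forgotten. The induction on the first letter is Pascal's rule. *)
Lemma card_excursions_level (T : finType) (dy : T -> int) n k (h : int) :
  #|[set w : n.-tuple (option T) |
      excursion (oapp dy 0) h w && (count_mem None w == k)]| =
  ('C(n, k) * num_excursions dy (n - k) h)%N.
Proof.
have card_neg m k' h' : h' < 0 ->
    #|[set w : m.-tuple (option T) |
        excursion (oapp dy 0) h' w && (count_mem None w == k')]| =
    ('C(m, k') * num_excursions dy (m - k') h')%N.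
  move=> h0; rewrite num_excursions_neg // muln0; apply/eqP; rewrite cards_eq0.
  by apply/eqP/setP=> w; rewrite !inE excursion_neg.
elim: n k h => [|n IHn] k h; have [h0|h0] := ltP h 0.
- exact: card_neg.
- have -> : [set w : 0.-tuple (option T) |
      excursion (oapp dy 0) h w && (count_mem None w == k)] =
     if (h == 0) && (k == 0%N) then [set: 0.-tuple (option T)] else finset.set0.
    apply/setP=> w; rewrite inE tuple0 /= h0 /= [0%N == k]eq_sym.
    by case: ifP; rewrite inE.
  case: k => [|k]; last by rewrite andbF cards0.
  by rewrite andbT num_excursions0; case: eqP => _;
    rewrite ?cards0 // cardsT card_tuple.
- exact: card_neg.
rewrite (card_tuple_cons n
  (fun w => excursion (oapp dy 0) h w && (count_mem None w == k))).
rewrite sum_option /= h0 /= addr0.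
rewrite (eq_bigr (fun s => 'C(n, k) * num_excursions dy (n - k) (h + dy s))%N);
  last by move=> s _; exact: IHn.
rewrite -big_distrr /=; case: k => [|k].
  rewrite !bin0 !subn0 -num_excursionsS //.
  under eq_finset => w do rewrite add1n andbF.
  by rewrite cards0 !mul1n.
under eq_finset => w do rewrite add1n eqSS.
rewrite IHn binS subSS.
(* For [k >= n] the length [n - k.+1] is truncated, but then the binomial coefficient vanishes. *)
have [ltkn|lenk] := ltnP k n.
  by rewrite -(subnSK ltkn) num_excursionsS // -mulnDl addnC.
by rewrite ['C(n, k.+1)]bin_small // add0n addn0.
Qed.

(** * Ballot numbers *)

Lemma eq_excursion (T : Type) (dy dy' : T -> int) : dy =1 dy' ->
  excursion dy =2 excursion dy'.
Proof. by move=> eq_dy h w; elim: w h => //= s w IHw h; rewrite IHw eq_dy. Qed.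

Lemma motzkin_excursions (m : nat) : motzkin m = num_excursions step_dy m 0.
Proof.
apply: eq_card => w; rewrite !inE; apply/andP/excursionP.
  move=> [/forallP ge0 /eqP eq0]; rewrite !add0r; split=> // j.
  rewrite size_tuple -ltnS => ltjm; rewrite add0r.
  exact: (ge0 (Ordinal ltjm)).
move=> [ge0 eq0]; split; last by rewrite /path_height -[X in X == 0]add0r eq0.
apply/forallP=> j; rewrite /path_height -[X in 0 <= X]add0r ge0 //.
by rewrite size_tuple -ltnS.
Qed.

Definition pm_dy (b : bool) : int := if b then 1 else -1.

Definition ballot (n h : nat) : nat := num_excursions pm_dy n h%:Z.

Lemma ballot0 (h : nat) : ballot 0 h = (h == 0%N).
Proof. by rewrite /ballot num_excursions0. Qed.

Lemma ballotS0 (n : nat) : ballot n.+1 0 = ballot n 1.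
Proof.
rewrite /ballot num_excursionsS // big_bool /= [X in (_ + X)%N]num_excursions_neg //.
by rewrite addn0.
Qed.

Lemma ballotSS (n h : nat) : ballot n.+1 h.+1 = (ballot n h.+2 + ballot n h)%N.
Proof.
rewrite /ballot num_excursionsS // big_bool /=.
by congr addn; congr num_excursions; lia.
Qed.

Lemma ballot_small (n h : nat) : (n < h)%N -> ballot n h = 0%N.
Proof.
elim: n h => [|n IHn] [|h] // ltnh; first by rewrite ballot0.
by rewrite ballotSS !IHn; lia.
Qed.

Lemma ballot_odd (n h : nat) : odd (n + h) -> ballot n h = 0%N.
Proof.
elim: n h => [|n IHn] [|h] oddnh; rewrite ?ballot0 //.
  by rewrite ballotS0 IHn //; lia.
by rewrite ballotSS !IHn //; lia.
Qed.

(** The ballot formula [(h + 1) / (j + h + 1) * C(2j + h, j)], cleared of denominators; [h = 0]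
    gives the Catalan numbers. Removing the first step leads to [(j - 1, h + 1)] or [(j, h - 1)]. *)
Lemma ballot_fact (j h : nat) :
  (ballot (j.*2 + h) h * ((j + h).+1)`! * j`! = h.+1 * (j.*2 + h)`!)%N.
Proof.
move En: (j.*2 + h)%N => n; elim: n j h En => [|n IHn] [|j] [|h] En; try lia.
- by rewrite ballot0.
- have -> : h = n by lia.
  rewrite ballotSS ballot_small ?add0n; last by lia.
  by have := IHn 0%N n erefl; rewrite !fact0 !muln1 !add0n !factS; nia.
- have := IHn j 1%N ltac:(lia); rewrite ballotS0 addn0 addn1 !factS.
  have -> : n = j.*2.+1 by lia.
  nia.
- have := IHn j h.+2 ltac:(lia); have := IHn j.+1 h ltac:(lia).
  rewrite ballotSS !addSn !addnS [((j + h).+3)`!]factS [(n.+1)`!]factS [(j.+1)`!]factS.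
  have -> : n = (j.*2 + h).+2 by lia.
  nia.
Qed.

Lemma motzkin_ballot (m : nat) :
  motzkin m = (\sum_(i < m.+1) 'C(m, i) * ballot i 0)%N.
Proof.
rewrite motzkin_excursions /num_excursions -sum1_card.
rewrite (partition_big
  (fun w : m.-tuple (option bool) => inord (count_mem None w) : 'I_m.+1) xpredT) //=.
(* After the reversal the index [i] counts the steps that are not level. *)
rewrite (reindex_inj rev_ord_inj) /=.
apply: eq_bigr => i _; rewrite -(bin_sub (ltnSE (ltn_ord i))).
rewrite /ballot -[X in num_excursions _ X _](subKn (ltnSE (ltn_ord i))).
rewrite -card_excursions_level -sum1_card; apply: eq_bigl => w; rewrite !inE.
have eq_dy : step_dy =1 oapp pm_dy 0 by case.
rewrite (eq_excursion eq_dy); congr andb.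
rewrite -val_eqE /= inordK ?subSS // ltnS.
by rewrite (leq_trans (count_size _ _)) // size_tuple.
Qed.

(** Both products count ordered pairs of disjoint subsets of sizes [k] and [i] in an [n]-set. *)
Lemma mul_bin_comm (n k i : nat) :
  ('C(n, k) * 'C(n - k, i) = 'C(n, i) * 'C(n - i, k))%N.
Proof.
have [lekin|ltnki] := leqP (k + i) n; last first.
  have zero a b : (n < a + b)%N -> ('C(n, a) * 'C(n - a, b) = 0)%N.
    move=> ltnab; have [lean|ltna] := leqP a n; last by rewrite bin_small.
    by rewrite ['C(n - a, b)]bin_small ?muln0 //; lia.
  by rewrite !zero // addnC.
have := @bin_fact n k ltac:(lia); have := @bin_fact n i ltac:(lia).
have := @bin_fact (n - k) i ltac:(lia); have := @bin_fact (n - i) k ltac:(lia).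
have -> : (n - k - i = n - i - k)%N by lia.
move=> <- <- <- eqf; apply/eqP.
rewrite -(eqn_pmul2r (_ : 0 < k`! * i`! * (n - i - k)`!)%N) ?muln_gt0 ?fact_gt0 //.
by apply/eqP; lia.
Qed.

(** Choosing the [i] non-level places first leaves [n - i] places, each level in one of two colours:
    the binomial expansion of [(1 + t) ^+ (n - i)]. *)
Lemma motzkin_genpoly (R : comNzRingType) (n : nat) (t : R) :
  \sum_(k < n.+1) ('C(n, k) * motzkin (n - k))%:R * t ^+ k =
  \sum_(i < n.+1) ('C(n, i) * ballot i 0)%:R * (1 + t) ^+ (n - i).
Proof.
transitivity (\sum_(k < n.+1) \sum_(i < n.+1)
    ('C(n, i) * 'C(n - i, k) * ballot i 0)%:R * t ^+ k).
  apply: eq_bigr => k _; rewrite -mulr_suml; congr (_ * _).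
  rewrite motzkin_ballot big_distrr /= -natr_sum; congr (_%:R).
  rewrite (big_ord_widen_cond n.+1 xpredT
    (fun i => 'C(n, k) * ('C(n - k, i) * ballot i 0))%N); last by lia.
  rewrite big_mkcond /=; apply: eq_bigr => i _.
  rewrite -mul_bin_comm -mulnA; case: ltnP => // ltki.
  by rewrite ['C(n - k, i)]bin_small ?muln0 //; lia.
rewrite exchange_big /=; apply: eq_bigr => i _.
have le_in : (i <= n)%N by rewrite -ltnS.
rewrite exprDn (big_ord_widen_cond n.+1 xpredT
   (fun k => 1 ^+ (n - i - k) * t ^+ k *+ 'C(n - i, k))); last by lia.
rewrite big_distrr /= [RHS]big_mkcond; apply: eq_bigr => k _.
rewrite expr1n mul1r -[t ^+ k *+ _]mulr_natl.
case: ltnP => lek; first by rewrite mulrA -natrM mulnAC.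
by rewrite ['C(n - i, k)]bin_small ?muln0 ?mul0n ?mul0r //; lia.
Qed.

(** * The hypergeometric sum *)

Lemma natr_ffactS (R : pzRingType) (n m : nat) :
  (n ^_ m.+1)%:R = (n ^_ m)%:R * (n%:R - m%:R) :> R.
Proof.
rewrite ffactnSr natrM; have [lemn|ltnm] := leqP m n; first by rewrite natrB.
by rewrite ffact_small // !mul0r.
Qed.

(** The two products interleave: [4 (-n/2 + i) ((1 - n)/2 + i) = (n - 2i) (n - 2i - 1)]. *)
Lemma pochhammer_half (K : numFieldType) (n j : nat) :
  pochhammer (- n%:R / 2 : K) j * pochhammer ((1 - n%:R) / 2) j * 4 ^+ j =
  (n ^_ j.*2)%:R.
Proof.
elim: j => [|j IHj]; first by rewrite /pochhammer !big_ord0 !mul1r.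
rewrite doubleS !natr_ffactS -IHj /pochhammer !big_ord_recr /= exprS.
rewrite -natr1 -addnn natrD.
by field.
Qed.

Lemma pochhammer2 (R : pzRingType) (j : nat) :
  pochhammer 2 j = (j.+1)`!%:R :> R.
Proof.
elim: j => [|j IHj]; first by rewrite /pochhammer big_ord0.
by rewrite /pochhammer big_ord_recr /= -/(pochhammer _ _) IHj -natrD -natrM mulnC -factS.
Qed.

(** The numerator becomes the falling factorial [n ^_ j.*2], and [ballot_fact] at height 0 turns
    [(2j)!] into the denominator [(j + 1)! j!] times a Catalan number. *)
Lemma hyp2F1_term_ballot (K : numFieldType) (n j : nat) (x : K) : x != 0 ->
  hyp2F1_term (- n%:R / 2) ((1 - n%:R) / 2) 2 (4 / x ^+ 2) j =
  ('C(n, j.*2) * ballot j.*2 0)%:R / x ^+ j.*2.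
Proof.
move=> x0; rewrite /hyp2F1_term pochhammer2 -natrM.
rewrite expr_div_n -exprM mul2n [LHS]mulrA; congr (_ / _).
rewrite mulrAC pochhammer_half.
apply: (canLR (mulfK _)).
  by rewrite pnatr_eq0 muln_eq0 negb_or -!lt0n !fact_gt0.
rewrite -natrM; congr (_%:R).
have := ballot_fact j 0; rewrite !addn0 mul1n => eqb.
by rewrite -bin_ffact -eqb !mulnA.
Qed.

Lemma sum_even (V : nmodType) (n : nat) (F : nat -> V) :
  (forall i, odd i -> F i = 0) ->
  \sum_(i < n.+1) F i = \sum_(j < n./2.+1) F j.*2.
Proof.
move=> F0; elim: n => [|n IHn]; first by rewrite !big_ord1.
rewrite big_ord_recr /= IHn; have [on|en] := boolP (odd n).
  rewrite uphalf_half on [RHS]big_ord_recr /=; congr (_ + F _).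
  by rewrite -[LHS](odd_double_half n.+1) /= on uphalf_half on.
by rewrite uphalf_half (negPf en) F0 ?addr0 //=; lia.
Qed.

(** According to the parity of [n], one of the upper parameters equals [- (n./2)], so the series is
    a finite sum; the odd terms on the right vanish because Dyck words have even length. *)
Lemma hyp2F1_ballot (K : numFieldType) (n : nat) (x : K) : x != 0 ->
  x ^+ n * hyp2F1 (- n%:R / 2) ((1 - n%:R) / 2) 2 (4 / x ^+ 2) =
  \sum_(i < n.+1) ('C(n, i) * ballot i 0)%:R * x ^+ (n - i).
Proof.
move=> x0.
have -> : hyp2F1 (- n%:R / 2) ((1 - n%:R) / 2) 2 (4 / x ^+ 2) =
    \sum_(j < n./2.+1) hyp2F1_term (- n%:R / 2) ((1 - n%:R) / 2) 2 (4 / x ^+ 2) j.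
  have [on|en] := boolP (odd n).
    have -> : (1 - n%:R) / 2 = - (n./2)%:R :> K.
      by rewrite -{1}(odd_double_half n) on natrD -muln2 natrM mulr1n; field.
    rewrite hyp2F1C hyp2F1_terminating; apply: eq_bigr => j _.
    by rewrite /hyp2F1_term (mulrC (pochhammer _ j)).
  have -> : - n%:R / 2 = - (n./2)%:R :> K.
    by rewrite -{1}(odd_double_half n) (negPf en) add0n -muln2 natrM; field.
  by rewrite hyp2F1_terminating.
rewrite (@sum_even _ n (fun i => ('C(n, i) * ballot i 0)%:R * x ^+ (n - i))); last first.
  by move=> i oi; rewrite ballot_odd ?addn0 // muln0 mul0r.
rewrite big_distrr /=; apply: eq_bigr => j _.
rewrite hyp2F1_term_ballot // mulrCA; congr (_ * _).
by rewrite expfB_cond ?(negPf x0) //=; have := ltn_ord j; lia.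
Qed.

(** * Lower ends of neighbourhoods and their bit words *)

Section PartialSums.
Local Open Scope nat_scope.

Definition psum (p : nat -> bool) (n : nat) : nat := \sum_(j < n) p j.

Lemma psumS p n : psum p n.+1 = psum p n + p n.
Proof. by rewrite /psum big_ord_recr. Qed.

Lemma leq_psum p m n : m <= n -> psum p m <= psum p n.
Proof.
move=> /subnK <-; elim: (n - m) => // d IHd.
by rewrite addSn psumS (leq_trans IHd) ?leq_addr.
Qed.

Lemma psum_const p m n : m <= n ->
  (forall j, m <= j < n -> p j = false) -> psum p n = psum p m.
Proof.
move=> /subnK <-; elim: (n - m) => // d IHd pF.
by rewrite addSn psumS pF ?addn0; [apply: IHd => j jd; apply: pF|]; lia.
Qed.

Lemma eq_psum p q n : (forall j, j < n -> p j = q j) -> psum p n = psum q n.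
Proof. by move=> eqpq; apply: eq_bigr => j _; rewrite eqpq. Qed.

(** Inverts the counting function [psum p]; the value is [n.+1] when the count [c] is not reached up
    to [n]. *)
Definition first_reach (p : nat -> bool) (n c : nat) : nat :=
  find (fun x => c <= psum p x) (iota 0 n.+1).

Variant first_reach_spec p n c x : Prop := FirstReachSpec of
  x <= n & psum p x = c & forall y, y < x -> psum p y < c.

Lemma first_reachP p n c : c <= psum p n ->
  first_reach_spec p n c (first_reach p n c).
Proof.
move=> lecn; set s := iota 0 n.+1.
have has_s : has (fun x => c <= psum p x) s.
  by apply/hasP; exists n => //; rewrite mem_iota; lia.
have lt_n : first_reach p n c < n.+1 by move: has_s; rewrite has_find size_iota.
have ge_c := nth_find 0 has_s; rewrite -/(first_reach p n c) nth_iota // in ge_c.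
have lt_c y : y < first_reach p n c -> psum p y < c.
  move=> lty; have := before_find 0 lty.
  by rewrite nth_iota ?add0n; [move/negbT; rewrite -ltnNge|lia].
split=> //; apply/eqP; rewrite eqn_leq ge_c andbT.
case: (first_reach p n c) ge_c lt_c => [|x] _ lt_c; first by rewrite /psum big_ord0.
by rewrite psumS; have := lt_c x (ltnSn x); case: (p x); lia.
Qed.

Lemma first_reach_leq p n c x : c <= psum p n -> c <= psum p x ->
  first_reach p n c <= x.
Proof.
by move=> lecn lecx; have [_ _ lt_c] := first_reachP lecn; case: leqP => // /lt_c; lia.
Qed.

End PartialSums.

(** The letter moves the height by [v - u]. The outer [None] is the bit pair (0,0), the colour that
    marks twins; [Some None] is the other level step (1,1). *)
Definition encode (u v : bool) : option (option bool) :=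
  if u == v then (if u then Some None else None) else Some (Some v).

Lemma encode_inj u v u' v' : encode u v = encode u' v' -> u = u' /\ v = v'.
Proof. by case: u u' v v' => [] [] [] []. Qed.

Lemma encode_surj s : exists u v, encode u v = s.
Proof.
case: s => [[[]|]|]; [exists false, true|exists true, false
  |exists true, true|exists false, false] => //.
Qed.

Lemma encode_excursion (u v : nat -> bool) (n : nat) :
  reflect ((forall i, (i <= n)%N -> (psum u i <= psum v i)%N) /\ psum u n = psum v n)
    (excursion (oapp step_dy 0) 0 (mkseq (fun j => encode (u j) (v j)) n)).
Proof.
have height i : 0 + \sum_(s <- mkseq (fun j => encode (u j) (v j)) i) oapp step_dy 0 s
    = (psum v i)%:Z - (psum u i)%:Z.
  rewrite add0r big_map -[i in iota 0 i]subn0 big_mkord.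
  elim: i => [|i IHi]; first by rewrite /psum !big_ord0.
  by rewrite big_ord_recr IHi !psumS /=; case: (u i) (v i) => [] [] /=; lia.
have takeE i : (i <= n)%N -> take i (mkseq (fun j => encode (u j) (v j)) n)
    = mkseq (fun j => encode (u j) (v j)) i.
  by move=> lein; rewrite /mkseq -map_take take_iota (minn_idPl lein).
apply: (iffP (excursionP _ _ _)); rewrite height size_mkseq.
  move=> [ge0 eq0]; split=> [i lein|]; last by lia.
  by have := ge0 i lein; rewrite takeE // height; lia.
move=> [le_uv eq_uv]; split=> [i lein|]; last by rewrite eq_uv subrr.
by rewrite takeE // height; have := le_uv i lein; lia.
Qed.

Section LowerEnds.
Local Open Scope nat_scope.

(** [l i] stands for the smallest vertex of the closed neighbourhood of [i]. The conditions are
    [0 <= a_i] and [a_{i+1} <= a_i + 1]. *)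
Definition lower_ends (n : nat) (l : nat -> nat) : Prop :=
  (forall i, i <= n -> l i <= i) /\ (forall i, i < n -> l i <= l i.+1).

Definition ascends (l : nat -> nat) (j : nat) : bool := l j < l j.+1.

(** The shift leaves out the value 0, which lower ends always take at index 0, so that there are [n]
    bits, as for [ascends]. *)
Definition hits (n : nat) (l : nat -> nat) (j : nat) : bool :=
  has (fun i => l i == j.+1) (iota 0 n.+1).

Lemma hitsP n l j : reflect (exists2 i, i <= n & l i = j.+1) (hits n l j).
Proof.
apply: (iffP hasP) => [[i]|[i lein eql]].
  by rewrite mem_iota add0n ltnS => lein /eqP; exists i.
by exists i; rewrite ?eql // mem_iota.
Qed.

Lemma lower_ends_homo n l i j : lower_ends n l -> i <= j -> j <= n -> l i <= l j.
Proof.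
move=> [_ homo_l] /subnK <-; elim: (j - i) => // d IHd led.
by rewrite (leq_trans (IHd _)) ?addSn ?homo_l //; lia.
Qed.

(** Both sides count the distinct nonzero values among [l 0, ..., l i]: by monotonicity each of them
    is entered at exactly one ascent. *)
Lemma psum_hits_ascends n l i : lower_ends n l -> i <= n ->
  psum (hits n l) (l i) = psum (ascends l) i.
Proof.
move=> le_l; have [l_le l_homo] := le_l.
elim: i => [|i IHi] lein.
  by have := l_le 0 lein; rewrite leqn0 => /eqP ->; rewrite /psum !big_ord0.
rewrite psumS -IHi; last by lia.
have := l_homo i lein; rewrite /ascends leq_eqVlt => /predU1P[->|ltl].
  by rewrite ltnn addn0.
rewrite ltl; case E: (l i.+1) => [|x]; first by lia.
rewrite psumS; congr (_ + nat_of_bool _); last by apply/hitsP; exists i.+1.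
(* Nothing strictly between [l i] and [l i.+1] is a value: up to [i] the values are at most [l i],
   afterwards at least [l i.+1]. *)
apply: psum_const => [|j /andP[lej ltj]]; first by lia.
apply/hitsP=> -[m lemn eqm].
have [lemi|ltim] := leqP m i.
  by have := lower_ends_homo le_l lemi; lia.
by have := lower_ends_homo le_l ltim; lia.
Qed.

(** This recovers [l] from its bits: a nonzero [l i] is itself a value, so the count of values first
    reaches its level exactly there. *)
Lemma lower_ends_first_reach n l i : lower_ends n l -> i <= n ->
  l i = first_reach (hits n l) n (psum (ascends l) i).
Proof.
move=> le_l lein; have eq_i := psum_hits_ascends le_l lein.
have [l_le _] := le_l; have le_i := l_le i lein.
have le_n : psum (ascends l) i <= psum (hits n l) n.
  by rewrite -eq_i leq_psum //; lia.
apply/eqP; rewrite eqn_leq andbC first_reach_leq ?eq_i //=.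
have [_ eq_r _] := first_reachP le_n; case E: (l i) => [|x] //.
rewrite ltnNge; apply/negP=> lerx.
have := leq_psum (hits n l) lerx; rewrite eq_r -eq_i E psumS.
suff -> : hits n l x by lia.
by apply/hitsP; exists i.
Qed.

(** The number of ascents before [i] is the number of nonzero values up to [l i], and [l i <= i]; no
    value exceeds [l n], whence equality at the end. *)
Lemma lower_ends_excursion n l : lower_ends n l ->
  (forall i, i <= n -> psum (ascends l) i <= psum (hits n l) i) /\
  psum (ascends l) n = psum (hits n l) n.
Proof.
move=> le_l; have [l_le _] := le_l; split=> [i lein|].
  by rewrite -(psum_hits_ascends le_l) // leq_psum // l_le.
rewrite -(psum_hits_ascends le_l) //; apply/esym/psum_const; first exact: l_le.
move=> j /andP[lej _]; apply/hitsP=> -[m lemn eqm].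
by have := lower_ends_homo le_l lemn (leqnn n); lia.
Qed.

Section FromBits.
Variables (n : nat) (u v : nat -> bool).
Hypothesis le_uv : forall i, i <= n -> psum u i <= psum v i.
Hypothesis eq_uv : psum u n = psum v n.

(** The converse passage, from bits to lower ends, takes the formula of [lower_ends_first_reach] as
    definition. *)
Definition lower_of_bits (i : nat) : nat := first_reach v n (psum u i).

Let le_un i : i <= n -> psum u i <= psum v n.
Proof. by move=> lein; rewrite -eq_uv leq_psum. Qed.

Lemma lower_of_bitsP : lower_ends n lower_of_bits.
Proof.
split=> i lein; first by rewrite first_reach_leq ?le_un ?le_uv.
apply: first_reach_leq; first by rewrite le_un // ltnW.
by have [_ -> _] := first_reachP (le_un lein); rewrite psumS leq_addr.
Qed.

Lemma lower_of_bits_ascends j : j < n -> ascends lower_of_bits j = u j.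
Proof.
move=> ltjn; rewrite /ascends; have [_ eq_j _] := first_reachP (le_un (ltnW ltjn)).
have [_ eq_j1 _] := first_reachP (le_un ltjn).
case uj: (u j); last by rewrite /lower_of_bits psumS uj addn0 ltnn.
rewrite ltnNge; apply/negP => /(leq_psum v).
by rewrite /lower_of_bits eq_j eq_j1 psumS uj; lia.
Qed.

Lemma lower_of_bits_hits j : j < n -> hits n lower_of_bits j = v j.
Proof.
move=> ltjn; apply/hitsP/idP => [[i lein eqi]|vj].
  have [_ eq_i lt_i] := first_reachP (le_un lein).
  rewrite -/(lower_of_bits i) eqi in eq_i lt_i.
  by have := lt_i j (ltnSn j); rewrite -eq_i psumS; case: (v j); lia.
(* Since the totals agree, [u] also reaches the count [psum v j.+1]; at the place where it does, the
   lower end is [j.+1], because [v j] has just raised the count. *)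
have le_c : psum v j.+1 <= psum u n by rewrite eq_uv leq_psum.
have [lein eq_i _] := first_reachP le_c; set i := first_reach u n _ in lein eq_i.
exists i => //; have [_ eq_l _] := first_reachP (le_un lein).
apply/eqP; rewrite eqn_leq first_reach_leq ?le_un ?eq_i //=.
rewrite ltnNge; apply/negP => /(leq_psum v).
by rewrite /lower_of_bits eq_l eq_i psumS vj; lia.
Qed.

End FromBits.
End LowerEnds.

(** * Area sequences as two-coloured Motzkin words *)

Section AreaSequences.
Variable n : nat.
Local Open Scope nat_scope.
Implicit Type a : {ffun 'I_n.+1 -> 'I_n.+1}.

Definition lower (a : {ffun 'I_n.+1 -> 'I_n.+1}) (i : nat) : nat := i - a (inord i).

Lemma lower_ord a (i : 'I_n.+1) : lower a i = i - a i.
Proof. by rewrite /lower inord_val. Qed.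

Lemma DP_lower a : a \in DP n.+1 -> lower_ends n (lower a).
Proof.
rewrite inE => /andP[/forallP le_a /forallP step_a]; split=> i lein.
  exact: leq_subr.
have := step_a (inord i) => /forallP /(_ (inord i.+1)) /implyP.
rewrite !inordK //; last by lia.
by move/(_ (eqxx _)); rewrite /lower; lia.
Qed.

Lemma DP_lowerK a i : a \in DP n.+1 -> i <= n -> a (inord i) = i - lower a i :> nat.
Proof.
rewrite inE => /andP[/forallP le_a _] lein; have := le_a (inord i).
by rewrite inordK // /lower; lia.
Qed.

Lemma lower_inj a b : a \in DP n.+1 -> b \in DP n.+1 ->
  (forall i, i <= n -> lower a i = lower b i) -> a = b.
Proof.
move=> DPa DPb eq_ab; apply/ffunP=> i; apply/val_inj => /=.
have lein : i <= n by rewrite -ltnS.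
by rewrite -(inord_val i) !DP_lowerK // eq_ab.
Qed.

Lemma lower_surj l : lower_ends n l ->
  exists2 a, a \in DP n.+1 & forall i, i <= n -> lower a i = l i.
Proof.
move=> [l_le l_homo]; exists [ffun i : 'I_n.+1 => inord (i - l i)].
  rewrite inE; apply/andP; split.
    apply/forallP=> i; rewrite ffunE inordK ?leq_subr // ltnS.
    exact: leq_trans (leq_subr _ _) (ltnSE (ltn_ord i)).
  apply/forallP=> i; apply/forallP=> j; apply/implyP=> /eqP eqj.
  have ltj := ltn_ord j; have lti := ltn_ord i.
  rewrite !ffunE !inordK; try lia.
  by rewrite eqj in ltj *; have := l_homo i ltj; lia.
by move=> i lein; rewrite /lower ffunE !inordK; have := l_le i lein; lia.
Qed.

(* [l_i = i - a_i] and the right end of the closed neighbourhood of [i] is the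
   last [m] with [l_m <= i]; the right ends at [j] and [j + 1] agree iff no
   [l_m] equals [j + 1]. *)
Lemma twin_pairE a (i j : 'I_n.+1) : a \in DP n.+1 -> j = i.+1 :> nat ->
  Gamma a i j && (neighbors (Gamma a) i :\ j == neighbors (Gamma a) j :\ i) =
  ~~ ascends (lower a) i && ~~ hits n (lower a) i.
Proof.
move=> DPa eq_j; have le_l := DP_lower DPa; have [l_le l_homo] := le_l.
have ltin : i < n by rewrite -ltnS -eq_j.
have le_ij := l_homo i ltin; have le_i := l_le i (ltnW ltin).
have adjE x y : Gamma a x y =
    ((y < x) && (lower a x <= y)) || ((x < y) && (lower a y <= x)).
  by rewrite /Gamma !lower_ord.
apply/andP/andP => [[adj /eqP/setP eqN]|].
  have lj_le : lower a j <= i by move: adj; rewrite adjE; lia.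
  rewrite /ascends -leqNgt -eq_j; split.
    rewrite leqNgt; apply/negP=> lt_ij.
    (* The vertex [lower a i], lying below [lower a j], is adjacent to [i] but not to [j]. *)
    have ltk : lower a i < n.+1 by lia.
    have := eqN (Ordinal ltk); rewrite !inE !adjE -!val_eqE /=; lia.
  apply/hitsP=> -[m lemn eqm].
  have ltmj : j < m.
    rewrite ltnNge; apply/negP=> lemj.
    by have := lower_ends_homo le_l lemj; have := ltn_ord j; lia.
  (* A vertex [m > j] with [lower a m = j] is adjacent to [j] but not to [i]. *)
  have := eqN (Ordinal (lemn : m < n.+1)); rewrite !inE !adjE -!val_eqE /=; lia.
rewrite /ascends -leqNgt -eq_j => -[le_ji /hitsP nohit].
rewrite eq_j in le_ji; have eq_l : lower a i = lower a j by rewrite eq_j; lia.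
split; first by rewrite adjE -eq_l; lia.
apply/eqP/setP=> k; rewrite !inE !adjE -!val_eqE /= -eq_l.
have nohit_k : lower a k != i.+1.
  by apply/eqP=> eqk; apply: nohit; exists k => //; rewrite -ltnS.
lia.
Qed.

Definition DP_word a : n.-tuple (option (option bool)) :=
  [tuple of mkseq (fun j => encode (ascends (lower a) j) (hits n (lower a) j)) n].

(** By [twin_pairE] the pair at [j] is a twin iff both bits vanish, which [encode] writes as
    [None]. *)
Lemma twin_DP_word a : a \in DP n.+1 -> twin (Gamma a) = count_mem None (DP_word a).
Proof.
move=> DPa; rewrite /= count_map -sum1_count -[n in iota 0 n]subn0 big_mkord sum1dep_card.
rewrite /twin.
pose f (j : 'I_n) : 'I_n.+1 * 'I_n.+1 := (widen_ord (leqnSn n) j, lift ord0 j).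
rewrite -(card_imset _ (f := f)); last by move=> i j [/val_inj].
apply: eq_card => -[i j]; rewrite !inE; apply/and3P/imsetP => /= [[/eqP eq_j adj eqN]|[x]].
  have ltin : i < n by have := ltn_ord j; lia.
  exists (Ordinal ltin); last by congr pair; apply: val_inj.
  rewrite inE /=; have := twin_pairE DPa eq_j; rewrite adj eqN /=.
  by rewrite /encode; case: ascends; case: hits.
rewrite inE => wx [-> ->].
have eq_S : lift ord0 x = (widen_ord (leqnSn n) x).+1 :> nat by [].
have := twin_pairE DPa eq_S; move: wx; rewrite /= /encode.
by case: ascends; case: hits => //= _ /andP[].
Qed.

(** The bits determine the lower ends by [lower_ends_first_reach], and these determine the area
    sequence. *)
Lemma DP_word_inj : {in DP n.+1 &, injective DP_word}.
Proof.
move=> a b DPa DPb /(congr1 val) /= eq_w; apply: lower_inj => // i lein.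
have eq_bits j : j < n -> ascends (lower a) j = ascends (lower b) j /\
    hits n (lower a) j = hits n (lower b) j.
  move=> ltjn; apply: encode_inj.
  by have := congr1 (fun w => nth None w j) eq_w; rewrite !nth_mkseq.
have eq_u : psum (ascends (lower a)) i = psum (ascends (lower b)) i.
  by apply: eq_psum => j ltji; have [|-> _] := eq_bits j; first by lia.
rewrite (lower_ends_first_reach (DP_lower DPa)) // eq_u.
rewrite (lower_ends_first_reach (DP_lower DPb) lein).
apply: eq_in_find => x; rewrite mem_iota => lexn; congr (_ <= _).
by apply: eq_psum => j ltjx; have [|_ ->] := eq_bits j; first by lia.
Qed.

Lemma DP_word_image :
  DP_word @: DP n.+1 = [set w : n.-tuple _ | excursion (oapp step_dy 0%R) 0%R w].
Proof.
apply/setP=> w; rewrite inE; apply/imsetP/idP => [[a DPa ->]|exc_w].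
  by apply/encode_excursion/lower_ends_excursion/DP_lower.
(* Letters are decoded into bit pairs one by one; positions past the end carry the default letter
   [None]. *)
have [u eq_u] : exists u : nat -> bool * bool, forall s,
    encode (u s).1 (u s).2 = nth None w s.
  suff /choice[u eq_u] : forall s, exists b, encode b.1 b.2 = nth None w s by exists u.
  by move=> s; have [x [y <-]] := encode_surj (nth None w s); exists (x, y).
have eq_w : w = mkseq (fun j => encode (u j).1 (u j).2) n :> seq _.
  apply: (@eq_from_nth _ None); rewrite size_tuple ?size_mkseq // => j ltjn.
  by rewrite nth_mkseq // eq_u.
move: exc_w; rewrite eq_w => /encode_excursion[le_uv eq_uv].
have [a DPa eq_l] := lower_surj (lower_of_bitsP le_uv eq_uv).
exists a => //; apply: val_inj; rewrite /= eq_w.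
apply: (@eq_from_nth _ None); rewrite !size_mkseq // => j ltjn.
rewrite !nth_mkseq // -(lower_of_bits_ascends eq_uv ltjn).
rewrite -(lower_of_bits_hits eq_uv ltjn); congr encode.
  by rewrite /ascends !eq_l // ltnW.
rewrite /hits; apply: eq_in_has => i; rewrite mem_iota ltnS => lein.
by rewrite eq_l.
Qed.

(** [DP_word] is a bijection onto two-coloured excursions that turns twins into letters [None];
    deleting these leaves Motzkin words. *)
Lemma tau_motzkin k : tau n.+1 k = 'C(n, k) * motzkin (n - k).
Proof.
rewrite motzkin_excursions -card_excursions_level /tau.
rewrite -[LHS](card_in_imset (f := DP_word)); last first.
  move=> a b; rewrite !finset.in_set => /andP[DPa _] /andP[DPb _].
  by apply: DP_word_inj; rewrite finset.in_set.
apply: eq_card => w; rewrite inE; apply/imsetP/andP.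
  move=> [a]; rewrite finset.in_set => /andP[DPa /eqP <-] ->.
  rewrite twin_DP_word //; split=> //.
  by have := imset_f DP_word DPa; rewrite DP_word_image inE.
move=> [exc_w /eqP eq_k].
have /imsetP[a DPa eq_w] : w \in DP_word @: DP n.+1 by rewrite DP_word_image inE.
by exists a => //; rewrite finset.in_set DPa twin_DP_word // -eq_w eq_k eqxx.
Qed.

End AreaSequences.

(** * The twin polynomial *)

Lemma twin_le (n : nat) (e : rel 'I_n) : (twin e <= n)%N.
Proof.
rewrite -[n in (_ <= n)%N]card_ord; apply: leq_trans (max_card (mem [set: 'I_n])).
rewrite /twin -(card_in_imset (f := fst)); first exact/subset_leq_card/finset.subsetT.
move=> [i j] [i' j']; rewrite !inE /= => /andP[/eqP eq_j _] /andP[/eqP eq_j' _] eq_i.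
by congr pair => //; apply: val_inj; rewrite /= eq_j eq_j' eq_i.
Qed.

Lemma twin_poly_tau (R : nzRingType) (n : nat) :
  twin_poly R n = \sum_(k < n.+1) (tau n k)%:R *: 'X^k.
Proof.
rewrite /twin_poly (partition_big (fun a => inord (twin (Gamma a)) : 'I_n.+1) xpredT) //=.
apply: eq_bigr => k _; rewrite scaler_nat -sumr_const.
apply: eq_big => [a|a /andP[_ /eqP <-]]; rewrite ?inE.
  by rewrite -val_eqE /= inordK // ltnS twin_le.
by rewrite inordK // ltnS twin_le.
Qed.

Theorem proposition6p3 (K : numFieldType) :
  [/\ forall n : nat, twin_poly K n = \sum_(k < n.+1) (tau n k)%:R *: 'X^k,
      forall n k : nat, (k <= n.+1)%N ->
        tau n.+1 k = ('C(n, k) * motzkin (n - k))%N,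
      forall n k : nat, (0 < n)%N -> tau n k = A091869 n k
    & forall (n : nat) (t : K), (0 < n)%N -> 1 + t != 0 ->
        (twin_poly K n).[t] =
          (1 + t) ^+ (n - 1) *
          hyp2F1 (- (n%:R - 1) / 2) ((2 - n%:R) / 2) 2 (4 / (1 + t) ^+ 2)].
Proof.
split=> [n|n k _|[|n] k // _|[|n] t // _ t1].
- exact: twin_poly_tau.
- exact: tau_motzkin.
- exact: tau_motzkin.
have -> : 2 - n.+1%:R = 1 - n%:R :> K by rewrite -natr1; ring.
have -> : n.+1%:R - 1 = n%:R :> K by rewrite -natr1; ring.
rewrite subn1 /= hyp2F1_ballot // -motzkin_genpoly twin_poly_tau.
(* The top term [k = n.+1] vanishes, leaving the range of [motzkin_genpoly]. *)
rewrite horner_sum big_ord_recr /= tau_motzkin bin_small // mul0n scale0r horner0 addr0.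
by apply: eq_bigr => k _; rewrite hornerZ hornerXn tau_motzkin.
Qed.
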